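(* Let $\{\mathcal{A},G,\sigma,\alpha\}$ be a $G$-crossed system with $G\neq\{e\}$. The commutant of $\tilde{\mathcal{A}}$ in $\mathcal{A}\rtimes_\alpha^\sigma G$ is $$\mathrm{Comm}(\tilde{\mathcal{A}})=\Big\{\sum_{s\in G} r_s\,\overline{s}\in\mathcal{A}\rtimes_\alpha^\sigma G\;\Big|\; r_s\,\sigma_s(a)=a\,r_s,\ \ \forall a\in\mathcal{A},\ s\in G\Big\}.$$
   Context: A $G$-crossed system is a quadruple $\{\mathcal{A},G,\sigma,\alpha\}$ consisting of a unital associative ring $\mathcal{A}$ (not necessarily commutative), a group $G$ with unit $e$, a map $\sigma:G\to\mathrm{Aut}(\mathcal{A})$, $x\mapsto\sigma_x$, into the ring automorphisms of $\mathcal{A}$, and a map $\alpha:G\times G\to U(\mathcal{A})$ into the group of invertible elements of $\mathcal{A}$, such that for all $x,y,z\in G$, $a\in\mathcal{A}$: (i) $\sigma_x(\sigma_y(a))=\alpha(x,y)\,\sigma_{xy}(a)\,\alpha(x,y)^{-1}$; (ii) $\alpha(x,y)\,\alpha(xy,z)=\sigma_x(\alpha(y,z))\,\alpha(x,yz)$; (iii) $\alpha(x,e)=\alpha(e,x)=1_{\mathcal{A}}$. The crossed product $\mathcal{A}\rtimes_\alpha^\sigma G$ is the free left $\mathcal{A}$-module with basis $\{\overline{g}: g\in G\}$ (a copy of $G$), made into an associative unital ring by the biadditive multiplication determined by $(a_1\overline{x})(a_2\overline{y})=a_1\sigma_x(a_2)\,\alpha(x,y)\,\overline{xy}$. Its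 elements are formal sums $\sum_{g\in G}a_g\overline{g}$ with $a_g\in\mathcal{A}$, all but finitely many zero. $\tilde{\mathcal{A}}=\{a\overline{e}\mid a\in\mathcal{A}\}$ is the embedded copy of $\mathcal{A}$, and $\mathrm{Comm}(\tilde{\mathcal{A}})=\{b\in\mathcal{A}\rtimes_\alpha^\sigma G\mid ab=ba\ \forall a\in\tilde{\mathcal{A}}\}$. *)

(* Defs.v *)
From HB Require Import structures.
From mathcomp Require Import all_boot all_algebra.
From mathcomp Require Import finmap monalg.
From mathcomp Require Import boolp classical_sets.

Set Implicit Arguments.
Unset Strict Implicit.
Unset Printing Implicit Defensive.

Import GRing.Theory.

Local Open Scope ring_scope.

(* The base ring is a pzRingType: unital, associative, not necessarily
   commutative, the zero ring being allowed. The group is written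
   multiplicatively and may be infinite. That alpha takes invertible values is
   recorded by carrying the (unique) two-sided inverses alphaV: unitRingType
   would assume decidable invertibility and exclude the zero ring. *)
Record crossed_system (A : pzRingType) (G : groupType) := CrossedSystem {
  sigma : G -> {rmorphism A -> A};
  sigma_bij : forall x, bijective (sigma x);
  alpha : G -> G -> A;
  alphaV : G -> G -> A;
  alphaVr : forall x y, alpha x y * alphaV x y = 1;
  alphaVl : forall x y, alphaV x y * alpha x y = 1;
  sigma_comp : forall x y a,
    sigma x (sigma y a) = alpha x y * sigma (x * y)%g a * alphaV x y;
  alpha_cocycle : forall x y z,
    alpha x y * alpha (x * y)%g z = sigma x (alpha y z) * alpha x (y * z)%g;
  alphax1 : forall x, alpha x 1%g = 1;
  alpha1x : forall x, alpha 1%g x = 1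
}.

(* Only the additive group of {malg A[G]}, the finitely supported functions
   from G to A, is reused from the library; scaling and multiplication are
   defined below. f@_g is the coefficient of f at g. *)
Definition crossed_product (A : pzRingType) (G : groupType)
  (S : crossed_system A G) : Type := {malg A[G]}.

HB.instance Definition _ (A : pzRingType) (G : groupType)
  (S : crossed_system A G) := GRing.Zmodule.on (crossed_product S).

Section CrossedProduct.
Context {A : pzRingType} {G : groupType} (S : crossed_system A G).

Implicit Types (a b c : A) (x y z g : G) (f h : crossed_product S).

Definition cp_monom a g : crossed_product S := << a *g g >>.

Definition cp_bar g : crossed_product S := cp_monom 1 g.

Definition cp_embed a : crossed_product S := cp_monom a 1%g.

Definition cp_scale a f : crossed_product S :=
  \sum_(x <- msupp f) cp_monom (a * f@_x) x.

Definition cp_mul f h : crossed_product S :=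
  \sum_(x <- msupp f) \sum_(y <- msupp h)
    cp_monom (f@_x * sigma S x h@_y * alpha S x y) (x * y)%g.

Lemma sigma1 a : sigma S 1%g a = a.
Proof.
have [s' sK _] := sigma_bij S 1%g; apply: (can_inj sK).
rewrite sigma_comp mulg1 alphax1 mul1r.
by have := alphaVr S 1%g 1%g; rewrite alphax1 mul1r => ->; rewrite mulr1.
Qed.

Lemma cp_coefZ a f g : (cp_scale a f)@_g = a * f@_g.
Proof.
rewrite [in RHS](monalgE f) /cp_scale !raddf_sum mulr_sumr.
by apply: eq_bigr => x _; rewrite /cp_monom /= !mcoeffU mulrnAr.
Qed.

Lemma cp_scaleA a b f : cp_scale a (cp_scale b f) = cp_scale (a * b) f.
Proof. by apply/malgP => g; rewrite !cp_coefZ mulrA. Qed.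

Lemma cp_scale1 : left_id 1 cp_scale.
Proof. by move=> f; apply/malgP => g; rewrite cp_coefZ mul1r. Qed.

Lemma cp_scaleDr : right_distributive cp_scale +%R.
Proof. by move=> a f h; apply/malgP => g; rewrite !(mcoeffD, cp_coefZ) mulrDr. Qed.

Lemma cp_scaleDl f : {morph cp_scale^~ f : a b / a + b}.
Proof. by move=> a b; apply/malgP => g; rewrite !(mcoeffD, cp_coefZ) mulrDl. Qed.

Lemma cp_mulw (d1 d2 : {fset G}) f h :
    (msupp f `<=` d1)%fset -> (msupp h `<=` d2)%fset ->
  cp_mul f h = \sum_(x <- d1) \sum_(y <- d2)
    cp_monom (f@_x * sigma S x h@_y * alpha S x y) (x * y)%g.
Proof.
move=> le1 le2; rewrite /cp_mul (big_fset_incl _ le1) /=.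
  apply: eq_bigr => x _; apply: big_fset_incl => // y _ /mcoeff_outdom ->.
  by rewrite rmorph0 mulr0 mul0r /cp_monom monalgU0.
move=> x _ /mcoeff_outdom fx.
by rewrite big1 // => y _; rewrite fx !mul0r /cp_monom monalgU0.
Qed.

Lemma cp_mulDl : left_distributive cp_mul +%R.
Proof.
move=> f1 f2 h.
rewrite (cp_mulw (msuppD_le _ _) (fsubset_refl _)).
rewrite (cp_mulw (fsubsetUl _ (msupp f2)) (fsubset_refl (msupp h))).
rewrite (cp_mulw (fsubsetUr (msupp f1) _) (fsubset_refl (msupp h))).
rewrite -big_split /=; apply: eq_bigr => x _.
rewrite -big_split /=; apply: eq_bigr => y _.
by rewrite mcoeffD !mulrDl /cp_monom monalgUD.
Qed.

Lemma cp_mulDr : right_distributive cp_mul +%R.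
Proof.
move=> f h1 h2.
rewrite (cp_mulw (fsubset_refl _) (msuppD_le _ _)).
rewrite (cp_mulw (fsubset_refl (msupp f)) (fsubsetUl _ (msupp h2))).
rewrite (cp_mulw (fsubset_refl (msupp f)) (fsubsetUr (msupp h1) _)).
rewrite -big_split /=; apply: eq_bigr => x _.
rewrite -big_split /=; apply: eq_bigr => y _.
by rewrite mcoeffD rmorphD mulrDr mulrDl /cp_monom monalgUD.
Qed.

Lemma cp_mul0l : left_zero 0 cp_mul.
Proof. by move=> f; apply: (addrI (cp_mul 0 f)); rewrite -cp_mulDl !addr0. Qed.

Lemma cp_mul0r : right_zero 0 cp_mul.
Proof. by move=> f; apply: (addrI (cp_mul f 0)); rewrite -cp_mulDr !addr0. Qed.

Lemma cp_mulUU a b x y :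
  cp_mul (cp_monom a x) (cp_monom b y)
    = cp_monom (a * sigma S x b * alpha S x y) (x * y)%g.
Proof. by rewrite (cp_mulw msuppU_le msuppU_le) !big_seq_fset1 !mcoeffUU. Qed.

Lemma cp_ind (P : crossed_product S -> Prop) :
    P 0 -> (forall f h, P f -> P h -> P (f + h)) ->
    (forall a x, P (cp_monom a x)) -> forall f, P f.
Proof.
move=> P0 PD PU f; rewrite (monalgE f).
apply: big_ind => [|f1 f2|x _]; [exact: P0|exact: PD|exact: PU].
Qed.

Lemma cp_mulA : associative cp_mul.
Proof.
move=> f h k; elim/cp_ind: f => [|f1 f2 IH1 IH2|a x].
- by rewrite !cp_mul0l.
- by rewrite !cp_mulDl IH1 IH2.
elim/cp_ind: h => [|h1 h2 IH1 IH2|b y].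
- by rewrite !(cp_mul0l, cp_mul0r).
- by rewrite !(cp_mulDl, cp_mulDr) IH1 IH2.
elim/cp_ind: k => [|k1 k2 IH1 IH2|c z].
- by rewrite !cp_mul0r.
- by rewrite !cp_mulDr IH1 IH2.
rewrite !cp_mulUU mulgA; congr (cp_monom _ _).
rewrite !rmorphM -!mulrA -alpha_cocycle sigma_comp; congr (_ * (_ * _)).
by rewrite !mulrA -(mulrA _ (alphaV S x y)) alphaVl mulr1.
Qed.

Lemma cp_mul1l : left_id (cp_bar 1%g) cp_mul.
Proof.
elim/cp_ind => [|f1 f2 IH1 IH2|a x]; first by rewrite cp_mul0r.
  by rewrite cp_mulDr IH1 IH2.
by rewrite cp_mulUU sigma1 alpha1x mul1g mul1r mulr1.
Qed.

Lemma cp_mul1r : right_id (cp_bar 1%g) cp_mul.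
Proof.
elim/cp_ind => [|f1 f2 IH1 IH2|a x]; first by rewrite cp_mul0l.
  by rewrite cp_mulDl IH1 IH2.
by rewrite cp_mulUU rmorph1 alphax1 mulg1 !mulr1.
Qed.

HB.instance Definition _ := GRing.Zmodule_isLmodule.Build A (crossed_product S)
  cp_scaleA cp_scale1 cp_scaleDr cp_scaleDl.

HB.instance Definition _ := GRing.Zmodule_isPzRing.Build (crossed_product S)
  cp_mulA cp_mul1l cp_mul1r cp_mulDl cp_mulDr.

Lemma cp_sumE f : f = \sum_(s <- msupp f) f@_s *: cp_bar s.
Proof.
rewrite [LHS](monalgE f); apply: eq_bigr => s _; apply/malgP => g.
by rewrite cp_coefZ /cp_bar /cp_embed /cp_monom !mcoeffU mulrnAr mulr1.
Qed.

Lemma cp_mulE a b x y :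
  (a *: cp_bar x) * (b *: cp_bar y)
    = (a * sigma S x b * alpha S x y) *: cp_bar (x * y)%g.
Proof.
have scale_bar c z : c *: cp_bar z = cp_monom c z.
  by apply/malgP => g; rewrite cp_coefZ /cp_bar /cp_embed /cp_monom !mcoeffU mulrnAr mulr1.
by rewrite !scale_bar -cp_mulUU.
Qed.

Lemma cp_embedE a : cp_embed a = a *: cp_bar 1%g.
Proof. by apply/malgP => g; rewrite cp_coefZ /cp_bar /cp_embed /cp_monom !mcoeffU mulrnAr mulr1. Qed.

End CrossedProduct.

Local Open Scope classical_set_scope.

Definition embedded_base (A : pzRingType) (G : groupType)
  (S : crossed_system A G) : set (crossed_product S) := range (cp_embed S).

Definition commutant (R : pzRingType) (X : set R) : set R :=
  [set b | forall a, X a -> a * b = b * a].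

Arguments embedded_base {A G} S.

(* Main.v *)
Require Import Defs.
From HB Require Import structures.
From mathcomp Require Import all_boot all_algebra.
From mathcomp Require Import finmap monalg.
From mathcomp Require Import boolp classical_sets.

Import GRing.Theory.

Local Open Scope ring_scope.
Local Open Scope classical_set_scope.

(** Multiplication by an element [a] of the base ring acts on an element [r]
    coefficient by coefficient. As [sigma 1] is the identity and the cocycle
    [alpha] is normalised, multiplication on the left sends the coefficient [r_s] to
    [a * r_s], and multiplication on the right sends it to [r_s * sigma_s a]
    ([mcoeff_embed_mul], [mcoeff_mul_embed]). The basis elements are free over
    the base ring, so [r] commutes with [a] exactly when these coefficients
    agree at every [s]. *)

Lemma mcoeff_embed_mul (A : pzRingType) (G : groupType)
    (S : crossed_system A G) (a : A) (r : crossed_product S) (s : G) :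
  (cp_embed S a * r)@_s = a * r@_s.
Proof.
elim/(@cp_ind A G S): r => [|f h IHf IHh|b x].
- by rewrite mulr0 mcoeff0 mulr0.
- by rewrite mulrDr !mcoeffD IHf IHh mulrDr.
rewrite [_ * _]cp_mulUU sigma1 alpha1x mulr1 mul1g.
by rewrite /cp_monom !mcoeffU mulrnAr.
Qed.

(** On a monomial [b x] the product carries the twist [sigma_x], whereas the
    formula at [s] shows [sigma_s]; the coefficient of [b x] at [s] vanishes
    unless [x = s], so nothing distinguishes the two twists. *)
Lemma mcoeff_mul_embed (A : pzRingType) (G : groupType)
    (S : crossed_system A G) (a : A) (r : crossed_product S) (s : G) :
  (r * cp_embed S a)@_s = r@_s * sigma S s a.
Proof.
elim/(@cp_ind A G S): r => [|f h IHf IHh|b x].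
- by rewrite mul0r mcoeff0 mul0r.
- by rewrite mulrDl !mcoeffD IHf IHh mulrDl.
rewrite [_ * _]cp_mulUU alphax1 mulr1 mulg1 /cp_monom !mcoeffU.
by case: eqP => [->|_]; rewrite ?mulr1n // !mulr0n mul0r.
Qed.

Theorem theorem4p1 (A : pzRingType) (G : groupType) (S : crossed_system A G)
    (hG : exists g : G, g <> 1%g) :
  commutant (embedded_base S) =
  [set r : crossed_product S |
    forall (a : A) (s : G), r@_s * sigma S s a = a * r@_s].
Proof.
apply/seteqP; split=> r /= commr.
  move=> a s; rewrite -mcoeff_embed_mul -mcoeff_mul_embed commr //.
  by exists a.
move=> _ [a _ <-]; apply/malgP => s.
by rewrite mcoeff_embed_mul mcoeff_mul_embed commr.
Qed.
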